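(* Let $n\geq 2$ be an integer and let $a_n\geq n$ be any constant. There exists a positive constant $c_n$, depending only on $n$ and $a_n$, with the following property. Let $\mathbb{F}$ be a field and let $\mathfrak{L}$ be a finite collection of $L$ lines in $\mathbb{F}^n$ such that, whenever $n$ lines of $\mathfrak{L}$ meet at a point, they form a joint there (i.e. their directions span $\mathbb{F}^n$). Then, for all positive integers $N$ such that $J_N\neq\emptyset$, there exists a subcollection of $\mathfrak{L}$ consisting of at most $a_n\cdot L/N^{1/n}$ lines such that at least $c_n\cdot|J_N|$ of the points of $J_N$ are joints for this subcollection.
   Context: A collection of lines is a set of distinct lines. A line in $\mathbb{F}^n$ is a set $\{v+tb : t\in\mathbb{F}\}$ with $v,b\in\mathbb{F}^n$, $b\neq 0$; $b$ is its direction. A joint formed by a collection of lines in $\mathbb{F}^n$ is a point lying in at least $n$ lines of the collection whose directions span $\mathbb{F}^n$. The multiplicity of a joint $x$ formed by $\mathfrak{L}$ is the number of (unordered) $n$-tuples of lines of $\mathfrak{L}$ through $x$ whose directions span $\mathbb{F}^n$. $J_N$ denotes the set of joints formed by $\mathfrak{L}$ of multiplicity at least $N$ and smaller than $2N$. *)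

(* Defs.v *)
From mathcomp Require Import all_boot all_order all_algebra.
From mathcomp Require Import finmap.
From mathcomp Require Import all_classical all_reals all_analysis.

Set Implicit Arguments.
Unset Strict Implicit.
Unset Printing Implicit Defensive.

Import GRing.Theory.

Local Open Scope classical_set_scope.
Local Open Scope ring_scope.

(* Lines are point sets, so a finite set of lines automatically consists of
   distinct lines, whatever base points and directions describe them. *)
Definition line_from (F : fieldType) (n : nat) (v b : 'rV[F]_n) :
    set 'rV[F]_n :=
  [set v + t *: b | t in setT].

Definition is_direction (F : fieldType) (n : nat) (l : set 'rV[F]_n)
    (b : 'rV[F]_n) : Prop :=
  b != 0 /\ exists v, l = line_from v b.

Definition is_line (F : fieldType) (n : nat) (l : set 'rV[F]_n) : Prop :=
  exists b, is_direction l b.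

(* Directions are unique up to a nonzero scalar, so the choice of [d] does not
   affect the span. *)
Definition directions_span (F : fieldType) (n : nat)
    (S : {fset set 'rV[F]_n}) : Prop :=
  exists d : set 'rV[F]_n -> 'rV[F]_n,
    (forall l, l \in S -> is_direction l (d l)) /\
    <<[seq d l | l <- S]>>%VS = fullv.

Definition meet_at (F : fieldType) (n : nat) (S : {fset set 'rV[F]_n})
    (x : 'rV[F]_n) : Prop :=
  forall l, l \in S -> l x.

Definition joint (F : fieldType) (n : nat) (L : {fset set 'rV[F]_n})
    (x : 'rV[F]_n) : Prop :=
  exists S : {fset set 'rV[F]_n},
    [/\ (S `<=` L)%fset, (n <= #|` S|)%N, meet_at S x & directions_span S].

Definition multiplicity (F : fieldType) (n : nat) (L : {fset set 'rV[F]_n})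
    (x : 'rV[F]_n) : nat :=
  #|` [fset S in fpowerset L |
        `[< [/\ #|` S| = n, meet_at S x & directions_span S] >]]%fset|.

Definition joints_mult (F : fieldType) (n : nat) (L : {fset set 'rV[F]_n})
    (N : nat) : set 'rV[F]_n :=
  [set x | joint L x /\ (N <= multiplicity L x < 2 * N)%N].

Lemma lines_meet_once (F : fieldType) (n : nat) (l m : set 'rV[F]_n)
    (x y : 'rV[F]_n) :
  is_line l -> is_line m -> x != y -> l x -> l y -> m x -> m y -> l = m.
Proof.
have key (k : set 'rV[F]_n) : is_line k -> x != y -> k x -> k y ->
    k = line_from x (y - x).
  move=> [b [b0 [v ->]]] nxy [s _ xE] [t _ yE].
  have ts0 : t - s != 0.
    apply: contraNneq nxy => /eqP; rewrite subr_eq0 => /eqP ts.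
    by rewrite -xE -yE ts.
  have dE : y - x = (t - s) *: b.
    by rewrite -xE -yE opprD addrACA subrr add0r scalerBl.
  rewrite dE; apply/seteqP; split => z /= [u _ <-].
    exists ((u - s) / (t - s)) => //.
    by rewrite scalerA divfK// -xE -addrA -scalerDl (addrC s) subrK.
  exists (s + u * (t - s)) => //.
  by rewrite -xE scalerA scalerDl addrA.
by move=> hl hm nxy lx ly mx my; rewrite (key l)// (key m).
Qed.

(* Without finiteness, [fset_set] of a set of joints would be the empty set. *)
Lemma finite_joints (F : fieldType) (n : nat) (L : {fset set 'rV[F]_n}) :
  (2 <= n)%N -> (forall l, l \in L -> is_line l) -> finite_set (joint L).
Proof.
move=> n2 lineL.
pose P := [set p : set 'rV[F]_n * set 'rV[F]_n |
  [/\ p.1 \in L, p.2 \in L & p.1 != p.2]].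
apply: (@sub_finite_set _ _ (\bigcup_(p in P) (p.1 `&` p.2))).
  move=> x [S [SL nS Sx _]].
  have : (1 < size (enum_fset S))%N by exact: leq_trans nS.
  case E : (enum_fset S) => [//|l [//|m s]] _.
  have lS : l \in S by rewrite -[_ \in _]/(l \in enum_fset S) E mem_head.
  have mS : m \in S.
    by rewrite -[_ \in _]/(m \in enum_fset S) E inE mem_head orbT.
  exists (l, m); last by split; apply: Sx.
  split => /=; [exact: (fsubsetP SL)|exact: (fsubsetP SL)|].
  have := fset_uniq S; rewrite E /= inE negb_or => /andP[/andP[]//].
apply: bigcup_finite.
  apply: (@sub_finite_set _ _ ([set` L] `*` [set` L])).
    by move=> [l m] [/= ? ? _].
  by apply: finite_setX; exact: finite_fset.
move=> [l m] [/= lL mL nlm].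
have [->//|/set0P[x [lx mx]]] := eqVneq (l `&` m) set0.
apply: (@sub_finite_set _ _ [set x]); last exact: finite_set1.
move=> y [ly my] /=; apply/eqP; apply: contraNT nlm => nyx.
apply/eqP; apply: (@lines_meet_once _ _ _ _ y x) => //; exact: lineL.
Qed.

(* Main.v *)
(* If [k] lines of [L] pass through a point of [J_N], then [k ^ n] is at least
   [N].  Choose lines in [n] rounds of [q = floor (|L| / N^(1/n))] lines each.
   In every round, a point that still needs a line has at least
   [k - (n - 1) >= k / n] unused lines through it, so a greedy choice gives a new
   line to a proportion at least [1 / (2n + 1)] of the surviving points.  After
   [n] rounds at most [n * |L| / N^(1/n)] lines have been used, and a proportion
   [(2n + 1)^(-n)] of [J_N] lies on [n] chosen lines, which span by hypothesis. *)

Require Import Defs.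
From mathcomp Require Import all_boot all_order all_algebra.
From mathcomp Require Import finmap.
From mathcomp Require Import all_classical all_reals all_analysis.
From mathcomp Require Import zify.

Import Order.TTheory GRing.Theory Num.Theory.

Local Open Scope classical_set_scope.
Local Open Scope ring_scope.

Lemma exists_ge_average {U : eqType} (L : seq U) (f : U -> nat) :
  (0 < size L)%N ->
  exists2 l, l \in L & (\sum_(l' <- L) f l' <= size L * f l)%N.
Proof.
elim: L => // u [|v L] IH _.
  by exists u; rewrite ?mem_head// big_seq1 mul1n.
have [//|l lL hl] := IH.
rewrite big_cons; have [ul|/ltnW lu] := leqP (f u) (f l).
  exists l; first by rewrite inE lL orbT.
  by rewrite [size _]/= mulSn leq_add.
exists u; first by rewrite mem_head.
by rewrite [size _]/= mulSn leq_add2l (leq_trans hl)// leq_mul2l lu orbT.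
Qed.

Lemma sum_count_exchange {T U : Type} (I : T -> U -> bool)
    (J : seq T) (L : seq U) :
  (\sum_(x <- J) count (I x) L = \sum_(l <- L) count (I^~ l) J)%N.
Proof.
transitivity (\sum_(x <- J) \sum_(l <- L) I x l)%N.
  apply: eq_bigr => x _; rewrite -sum1_count [LHS]big_mkcond.
  by apply: eq_bigr => l _; case: (I x l).
rewrite exchange_big/=.
apply: eq_bigr => l _; rewrite -sum1_count [RHS]big_mkcond.
by apply: eq_bigr => x _; case: (I x l).
Qed.

(* Greedy choice: the most incident line hits a proportion [p = d / size L] of
   the points still missed, and [(1 - p)(1 + p(q + 1)) <= 1 + pq]. *)
Lemma greedy_hitting {T U : eqType} (I : T -> U -> bool)
    (J : seq T) (L : seq U) (d q : nat) :
  (0 < size L)%N -> (forall x, x \in J -> (d <= count (I x) L)%N) ->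
  exists s : seq U, [/\ {subset s <= L}, (size s <= q)%N &
    (count (fun x => ~~ has (I x) s) J * (size L + d * q)
       <= size L * size J)%N].
Proof.
move=> L0 dJ; elim: q => [|q [s [sL sq hs]]].
  exists [::]; split => //=.
  by rewrite muln0 addn0 mulnC leq_mul2l count_size orbT.
set V := [seq x <- J | ~~ has (I x) s].
have [l lL hl] := exists_ge_average L (fun l => count (I^~ l) V) L0.
(* Double counting: each point of [V] is on at least [d] lines, and [l] does at least as well as the
   average line. *)
have dV : (d * size V <= size L * count (I^~ l) V)%N.
  apply: leq_trans hl; rewrite -sum_count_exchange -[size V]sum1_size big_distrr.
  rewrite big_seq [leqRHS]big_seq; apply: leq_sum => x.
  by rewrite /= muln1 mem_filter => /andP[_ /dJ].
exists (l :: s); split => //.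
  by move=> u; rewrite inE => /predU1P[->//|/sL].
have sV : size V = count (fun x => ~~ has (I x) s) J by rewrite size_filter.
have sVl : (count (fun x => ~~ has (I x) (l :: s)) J + count (I^~ l) V =
    size V)%N.
  rewrite -(count_predC (I^~ l) V) addnC; congr addn.
  by rewrite count_filter; apply: eq_count => x /=; rewrite negb_or.
apply: (leq_trans _ hs).
rewrite -sV -sVl; rewrite -sVl in dV.
set y := count _ J in dV *; set z := count _ V in dV *.
(* It remains to see [d * y <= z * (size L + d * q)]; [dV] bounds even [d * (y + z)] by
   [size L * z]. *)
nia.
Qed.

(* Each round of [greedy_hitting] gives one more line to a proportion
   [1 / m.+1] of the surviving points. *)
Lemma iterated_greedy_hitting {T U : eqType} (I : T -> U -> bool)
    (J : seq T) (L : seq U) (d q m n : nat) :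
  uniq L -> (0 < size L)%N -> (size L <= m * (d * q))%N ->
  (forall x, x \in J -> (d + n.-1 <= count (I x) L)%N) ->
  exists s : seq U, [/\ uniq s, {subset s <= L}, (size s <= n * q)%N &
    (size J <= m.+1 ^ n * count (fun x => n <= count (I x) s) J)%N].
Proof.
move=> uL L0 Lm; elim: n => [|n IH] dJ.
  exists [::]; split => //=.
  by rewrite expn0 mul1n (eq_count (a2 := predT))// count_predT.
have [|s [us sL sq hs]] := IH.
  by move=> x /dJ; apply: leq_trans; rewrite leq_add2l leq_pred.
set J' := [seq x <- J | n <= count (I x) s]%N.
(* Points already on more than [n] lines of [s] count as hit by any line. *)
pose I' x l := (n < count (I x) s)%N || (I x l && (l \notin s)).
have [x|s' [s'L s'q hs']] := @greedy_hitting _ _ I' J' L d q L0.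
  rewrite mem_filter => /andP[nx /dJ/= dx]; rewrite /I'.
  have [nlt|ngt] := ltnP n (count (I x) s).
    rewrite count_predT.
    exact: leq_trans (leq_trans (leq_addr _ _) dx) (count_size _ _).
  (* At most [n] of the at least [d + n] lines through [x] are in [s], so at least [d] of them are
     new. *)
  have uIL : uniq [seq l <- L | I x l] by rewrite filter_uniq.
  rewrite -(leq_add2r n) (leq_trans dx)// (leq_trans _ (leq_add (leqnn _) ngt))//.
  rewrite -!size_filter -size_cat uniq_leq_size// => l.
  rewrite mem_cat !mem_filter => /andP[-> ->].
  by rewrite !andbT; case: (l \in s); rewrite // orbT.
(* The greedy list [s'] may repeat lines or reuse those of [s]; [undup] makes the counts concern
   distinct lines. *)
exists (undup (s ++ s')); split.
- exact: undup_uniq.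
- by move=> l; rewrite mem_undup mem_cat => /orP[/sL|/s'L].
- by rewrite (leq_trans (size_undup _))// size_cat mulSn addnC leq_add.
have hit : (count (fun x => has (I' x) s') J' <=
    count (fun x => n < count (I x) (undup (s ++ s'))) J)%N.
  rewrite count_filter; apply: sub_count => x /= /andP[/hasP[l ls' I'xl] nx].
  rewrite -size_filter.
  have [nlt|ngt] := ltnP n (count (I x) s).
    rewrite (leq_trans nlt)// -size_filter uniq_leq_size ?filter_uniq// => k.
    by rewrite !mem_filter mem_undup mem_cat => /andP[-> ->].
  move: I'xl; rewrite /I' ltnNge ngt/= => /andP[Ixl lns].
  rewrite (@leq_trans (size (l :: [seq k <- s | I x k])))//=.
    by rewrite size_filter.
  rewrite -[X in (X < _)%N]/(size _) -[X in (X <= _)%N]/(size (l :: _)).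
  apply: uniq_leq_size => /=.
    by rewrite mem_filter (negbTE lns) andbF filter_uniq.
  move=> k; rewrite inE !mem_filter mem_undup mem_cat.
  by move=> /predU1P[->|/andP[-> ->]//]; rewrite Ixl ls' orbT.
have dq0 : (0 < d * q)%N by case: (d * q)%N Lm => //; rewrite muln0; case: size L0.
have J'E := count_predC (fun x => has (I' x) s') J'.
(* With [h] points hit and [u] missed, the greedy bound says [u * (d * q) <= size L * h]; bounding
   [size L] and cancelling [d * q] gives [u <= m * h]. *)
have hJ' : (size J' <= m.+1 * count (fun x => has (I' x) s') J')%N.
  rewrite -J'E in hs' *; move: hs'.
  set u := count (predC _) _; set h := count _ _.
  move=> hs'.
  rewrite mulSn leq_add2l -(leq_pmul2r dq0).
  nia.
rewrite (leq_trans hs)// expnSr -mulnA leq_mul2l -size_filter.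
by rewrite (leq_trans hJ') ?orbT// leq_mul2l hit orbT.
Qed.

(** Each counted set is the set of entries of an [n]-tuple of lines through [x], and [k] lines have
    [k ^ n] such tuples. *)
Lemma multiplicity_le {F : fieldType} {n : nat} (L : {fset set 'rV[F]_n})
    (x : 'rV[F]_n) :
  (multiplicity L x <= count (fun l : set _ => `[< l x >]) L ^ n)%N.
Proof.
rewrite -size_filter; set K := [seq l : set _ <- L | _].
have uK : uniq K by rewrite filter_uniq ?fset_uniq.
rewrite -(card_seq_sub uK) -card_tuple cardE.
pose f (t : n.-tuple (seq_sub K)) := [fset l in [seq val i | i <- t]]%fset.
rewrite -(size_map f) (leq_trans _ (size_undup _))// -card_fseq.
apply: fsubset_leq_card; apply/fsubsetP => S.
rewrite !inE/= fpowersetE => /andP[SL /asboolP[Sn Sx _]].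
have SK : {subset S <= K}.
  move=> l lS; rewrite mem_filter (fsubsetP SL _ lS) andbT.
  by apply/asboolP; exact: Sx lS.
have sz : size (pmap (insub : _ -> option (seq_sub K)) S) == n.
  by rewrite size_pmap_sub -[X in _ == X]Sn -all_count; apply/allP.
apply/mapP; exists (Tuple sz); first by rewrite mem_enum.
apply/fsetP => l; rewrite !inE /=.
rewrite (pmap_filter (insubK (seq_sub K))) mem_filter isSome_insub.
by case: (boolP (l \in S)) => [/SK ->|]; rewrite ?andbF.
Qed.

(** Any [n] of the lines of [s] through [x] span by hypothesis; the first [n] are taken. *)
Lemma joint_mem_seq {F : fieldType} {n : nat} (L : {fset set 'rV[F]_n})
    (s : seq (set 'rV[F]_n)) (x : 'rV[F]_n) :
  (forall S : {fset set 'rV[F]_n}, (S `<=` L)%fset -> #|` S| = n ->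
     meet_at S x -> directions_span S) ->
  uniq s -> {subset s <= L} ->
  (n <= count (fun l : set _ => `[< l x >]) s)%N ->
  joint [fset l in s]%fset x.
Proof.
move=> spanL us sL; rewrite -size_filter.
set t := [seq l <- s | _] => nt.
have ut : uniq (take n t) by rewrite take_uniq ?filter_uniq.
have tE (l : set 'rV[F]_n) : l \in [fset l in take n t]%fset -> l x /\ l \in s.
  by rewrite !inE => /mem_take; rewrite mem_filter => /andP[/asboolP].
have cardt : #|` [fset l in take n t]%fset| = n.
  by rewrite card_fseq undup_id// size_takel.
have meett : meet_at [fset l in take n t]%fset x by move=> l /tE[].
exists [fset l in take n t]%fset; split => //.
- by apply/fsubsetP => l /tE[_]; rewrite inE.
- by rewrite cardt.
- by apply: spanL => //; apply/fsubsetP => l /tE[_ /sL].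
Qed.

Lemma rootn_le_nat {R : realType} (n N m : nat) :
  (0 < n)%N -> (N <= m ^ n)%N -> N%:R `^ n%:R^-1 <= m%:R :> R.
Proof.
move=> n0 Nm.
have -> : m%:R = ((m ^ n)%:R : R) `^ n%:R^-1.
  rewrite natrX -powR_mulrn ?ler0n// -powRrM divff ?powRr1 ?ler0n//.
  by rewrite pnatr_eq0 -lt0n.
by apply: ge0_ler_powR; rewrite ?invr_ge0 ?nnegrE ?ler0n ?ler_nat.
Qed.

Theorem lemma7p0p9 (R : realType) (n : nat) (a : R)
    (hn : (2 <= n)%N) (ha : n%:R <= a) :
  exists c : R, 0 < c /\
    forall (F : fieldType) (L : {fset set 'rV[F]_n}),
      (forall l, l \in L -> is_line l) ->
      (forall (S : {fset set 'rV[F]_n}) (x : 'rV[F]_n),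
         (S `<=` L)%fset -> #|` S| = n -> meet_at S x -> directions_span S) ->
      forall N : nat, (0 < N)%N -> joints_mult L N !=set0 ->
        exists L' : {fset set 'rV[F]_n},
          [/\ (L' `<=` L)%fset,
              #|` L'|%:R <= a * #|` L|%:R / (N%:R `^ n%:R^-1) &
              c * #|` fset_set (joints_mult L N)|%:R <=
                #|` fset_set (joints_mult L N `&` joint L')|%:R].
Proof.
have n0 : (0 < n)%N := ltnW hn.
(* Each of the [n] rounds keeps a proportion [1 / m.+1] of the points, with [m = 2 * n]. *)
exists ((2 * n).+1 ^ n)%:R^-1.
split; first by rewrite invr_gt0 ltr0n expn_gt0.
move=> F L lineL spanL N N0 [x0 x0J].
pose I (x : 'rV[F]_n) (l : set 'rV[F]_n) := `[< l x >].
have countI x : joints_mult L N x ->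
    (n <= count (I x) L)%N /\ (N <= count (I x) L ^ n)%N.
  move=> [[S [SL nS Sx _]] /andP[Nx _]].
  split; last exact: leq_trans (multiplicity_le L x).
  rewrite (leq_trans nS)// -size_filter uniq_leq_size ?fset_uniq// => l lS.
  rewrite mem_filter (fsubsetP SL _ lS) andbT.
  by apply/asboolP; exact: Sx lS.
have finJ : finite_set (joints_mult L N).
  by apply: sub_finite_set (finite_joints hn lineL) => x [].
set J := fset_set (joints_mult L N).
have JP x : x \in J -> joints_mult L N x by rewrite in_fset_set// inE.
have exd : exists d, (N <= (n * d) ^ n)%N.
  exists N; rewrite expnMn (leq_trans (leq_pexp2l N0 n0))//.
  by rewrite leq_pmull ?expn_gt0 ?n0.
(* This is the ceiling of [N^(1/n) / n], described without real roots. *)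
pose d := ex_minn exd.
have Nd : (N <= (n * d) ^ n)%N by rewrite /d; case: ex_minnP.
have dI x : x \in J -> (d + n.-1 <= count (I x) L)%N.
  move=> /JP/countI[nk Nk].
  suff : (d <= count (I x) L - n.-1)%N by lia.
  (* With [k = count (I x) L], minimality of [d] reduces the claim to [k <= n * (k - (n - 1))], that
     is, [(n - 1) * (k - n) >= 0]. *)
  rewrite /d; case: ex_minnP => m _; apply.
  rewrite (leq_trans Nk)// leq_exp2r//.
  nia.
set s : R := N%:R `^ n%:R^-1.
have s0 : 0 < s by rewrite powR_gt0 ?ltr0n.
have [nk0 Nk0] := countI _ x0J.
(* The given point [x0] of [J_N] forces [N <= #|L| ^ n]; hence [q] below is positive. *)
have sL : s <= #|` L|%:R.
  by rewrite rootn_le_nat// (leq_trans Nk0)// leq_exp2r// count_size.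
have snd : s <= (n * d)%:R by exact: rootn_le_nat.
have Ls0 : 0 <= #|` L|%:R / s :> R by rewrite divr_ge0 ?ler0n ?ltW.
pose q := Num.truncn (#|` L|%:R / s : R).
have [qL Lq] : q%:R <= #|` L|%:R / s :> R /\ #|` L|%:R / s < q.+1%:R :> R.
  by have /andP[] := truncn_itv Ls0.
have q1 : (0 < q)%N by rewrite truncn_gt0 ler_pdivlMr// mul1r.
(* Here [#|L| / s < q.+1 <= 2 * q] and [s <= n * d]: the factor 2 pays for rounding down to [q]. *)
have Lm : (size L <= 2 * n * (d * q))%N.
  rewrite -(ler_nat R) -(divfK (lt0r_neq0 s0) (size L)%:R).
  rewrite (_ : 2 * n * (d * q) = (2 * q) * (n * d))%N; last by lia.
  rewrite natrM ler_pM// ?(ltW s0)//.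
  by rewrite (le_trans (ltW Lq))// ler_nat; lia.
have L0 : (0 < size L)%N.
  by rewrite (leq_trans n0)// (leq_trans nk0)// count_size.
have [t [ut tL tq hit]] :=
  iterated_greedy_hitting _ _ _ _ _ _ _ (fset_uniq L) L0 Lm dI.
exists [fset l in t]%fset; split.
- by apply/fsubsetP => l; rewrite inE => /tL.
- rewrite card_fseq undup_id// -mulrA.
  rewrite (@le_trans _ _ (n%:R * (#|` L|%:R / s)))//; last by rewrite ler_wpM2r.
  rewrite (@le_trans _ _ (n * q)%:R) ?ler_nat//.
  by rewrite natrM ler_wpM2l ?ler0n.
- rewrite mulrC ler_pdivrMr ?ltr0n ?expn_gt0// -natrM ler_nat mulnC.
  rewrite (leq_trans hit)// leq_mul2l -size_filter; apply/orP; right.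
  apply: uniq_leq_size; first by rewrite filter_uniq ?fset_uniq.
  move=> x; rewrite mem_filter => /andP[nx /JP xJ].
  rewrite in_fset_set; last exact: finite_setIl.
  rewrite inE; split => //.
  by apply: (joint_mem_seq L) => // S; exact: spanL.
Qed.
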